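(* Let $Q$ be a medial quandle. If the orbit sizes are coprime, then $Q$ is $3$-reductive.
   Context: A quandle is a set $Q$ with a binary operation such that for all $x,y,z\in Q$: $xx=x$; $x(yz)=(xy)(xz)$; and the equation $xu=y$ has a unique solution $u\in Q$. It is medial if $(xy)(uv)=(xu)(yv)$ for all $x,y,u,v\in Q$. The left translation by $a\in Q$ is the permutation $L_a(x)=ax$ of $Q$; $\mathrm{LMlt}(Q)$ is the permutation group generated by all $L_a$, $a\in Q$. The orbits of $Q$ are the orbits of the natural action of $\mathrm{LMlt}(Q)$ on $Q$. The orbit sizes are the cardinalities of the orbits, and ''coprime'' is meant for the whole family of orbit sizes (their greatest common divisor is $1$), not pairwise. A set with a binary operation is $m$-reductive if $(R_y)^m(x)=y$ for all $x,y$, where $R_y(x)=xy$; i.e., $(((xy)y)\cdots)y=y$ with $m$ multiplications by $y$ on the right. *)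

(* Defs.v *)
From mathcomp Require Import all_boot.
From mathcomp Require Import boolp classical_sets functions cardinality.

Set Implicit Arguments.
Unset Strict Implicit.
Unset Printing Implicit Defensive.

Local Open Scope classical_set_scope.
Local Open Scope card_scope.

Definition is_quandle (Q : Type) (op : Q -> Q -> Q) : Prop :=
  [/\ forall x, op x x = x,
      forall x y z, op x (op y z) = op (op x y) (op x z)
    & forall x y, exists! u, op x u = y].

Definition medial (Q : Type) (op : Q -> Q -> Q) : Prop :=
  forall x y u v, op (op x y) (op u v) = op (op x u) (op y v).

(* The permutation group generated by the left translations, as a set of
   functions. *)
Inductive LMlt (Q : Type) (op : Q -> Q -> Q) : set (Q -> Q) :=
| LMlt_gen a : LMlt op (op a)
| LMlt_id : LMlt op id
| LMlt_comp g h : LMlt op g -> LMlt op h -> LMlt op (g \o h)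
| LMlt_inv g h : LMlt op g -> cancel g h -> cancel h g -> LMlt op h.

Definition orbit_of (Q : Type) (op : Q -> Q -> Q) (x : Q) : set Q :=
  [set g x | g in LMlt op].

Definition orbits (Q : Type) (op : Q -> Q -> Q) : set (set Q) :=
  range (orbit_of op).

(* The gcd of the sizes of all the orbits is 1.  An infinite cardinal is a
   multiple of every positive integer, so an infinite orbit imposes no
   condition on a common divisor d; if every orbit is infinite (or Q is empty)
   every positive d is a common divisor and the property fails. *)
Definition coprime_orbit_sizes (Q : Type) (op : Q -> Q -> Q) : Prop :=
  forall d : nat,
    (forall (O : set Q) (n : nat), orbits op O -> O #= `I_n -> d %| n) ->
    d = 1.

Definition reductive (m : nat) (Q : Type) (op : Q -> Q -> Q) : Prop :=
  forall x y, iter m (fun z => op z y) x = y.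

(* Main.v *)
Require Import Defs.
From mathcomp Require Import all_boot.
From mathcomp Require Import boolp classical_sets functions cardinality.

(** In a medial quandle the displacements [L_a L_b^-1] commute with one another,
    and they have the same orbits as [LMlt op].  Fix [x] and [y], and let
    [alpha = L_x L_y^-1].  As [alpha] is an automorphism, [L_(alpha z)] is the
    conjugate of [L_z] by [alpha], so [L_(alpha z) L_z^-1] is a commutator of
    [alpha] with [L_z]; commutation of displacements makes it independent of
    [z].  Call it [delta].  Telescoping gives
    [delta^n = L_(alpha^n z) L_z^-1] for every [z] ([iter_commutator]).

    If the orbit of [z] has [n] elements, then [alpha] commutes with a family of
    permutations that is transitive on it; all cycles of [alpha] there have the
    same length, this length divides [n], and [alpha^n z = z]
    ([iter_card_fixed]).  Hence [delta^n = 1] for every finite orbit size [n].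
    As these sizes are coprime, [delta = 1].  Evaluating at [y] with [z = y]
    gives [(x y) y = y].  This is already 2-reductivity, and 3-reductivity
    follows by idempotence. *)

Set Implicit Arguments.
Unset Strict Implicit.
Unset Printing Implicit Defensive.

Local Open Scope classical_set_scope.
Local Open Scope card_scope.

(** * Periods of self-maps *)

(** The least positive period if there is one, and [0] otherwise; in the latter
    case the divisibility clause says that only [n = 0] is a period. *)
Lemma exists_period (T : Type) (s : T -> T) (w : T) :
  exists d, iter d s w = w /\ forall n, iter n s w = w -> d %| n.
Proof.
case: (pselect (exists n, (0 < n) && `[< iter n s w = w >])) => [ex|nex].
  case: (ex_minnP ex) => d /andP[d_gt0 /asboolP sd] dmin.
  exists d; split=> // n sn.
  have mult q : iter (q * d) s w = w.
    by elim: q => // q IHq; rewrite mulSn iterD IHq.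
  have sr : iter (n %% d) s w = w.
    by move: sn; rewrite {1}(divn_eq n d) addnC iterD mult.
  rewrite /dvdn; case: posnP => // r_gt0.
  have := dmin (n %% d); rewrite r_gt0 asboolT // => /(_ isT).
  by rewrite leqNgt ltn_mod d_gt0.
exists 0; split=> // n sn; case: n sn => // n sn.
by case: nex; exists n.+1; apply/asboolP.
Qed.

(** A map [h] that commutes with [f] sends the cycle of [i] onto that of
    [h i]. *)
Lemma leq_order_commute (T : finType) (f h : T -> T) (i : T) :
  (forall k, h (f k) = f (h k)) -> order f (h i) <= order f i.
Proof.
move=> hf; have hfn n k : h (iter n f k) = iter n f (h k).
  by elim: n => //= n <-; rewrite hf.
apply: leq_trans (leq_image_card h _).
apply/subset_leq_card/fintype.subsetP => j /iter_findex <-.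
by rewrite -hfn; apply: map_f; rewrite mem_enum; apply: fconnect_iter.
Qed.

(** A transitive centralizer makes all cycles of [f] equally long, and their
    common length divides the number of points. *)
Lemma iter_card_finType (T : finType) (f : T -> T) :
  injective f ->
  (forall i j, exists2 h, h i = j & forall k, h (f k) = f (h k)) ->
  forall i, iter #|T| f i = i.
Proof.
move=> f_inj trans i.
have order_const : T \subset order_set f (order f i).
  apply/fintype.subsetP => j _; rewrite inE eqn_leq; apply/andP; split.
    by have [h <- hf] := trans i j; apply: leq_order_commute.
  by have [h <- hf] := trans j i; apply: leq_order_commute.
have cl : fclosed f T by [].
rewrite -(fcard_order_set f_inj order_const cl).
by elim: (fcard _ _) => // q IHq; rewrite mulSn iterD IHq (iter_order f_inj).
Qed.

Lemma iter_card_fixed (T : Type) (O : set T) (n : nat) (f : T -> T) :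
  O #= `I_n -> injective f -> {homo f : u / O u} ->
  (forall u v, O u -> O v ->
    exists h, [/\ h u = v, {homo h : w / O w} & forall w, h (f w) = f (h w)]) ->
  forall u, O u -> iter n f u = u.
Proof.
move=> /card_set_bijP[e [eO e_inj e_surj]] f_inj fO trans u Ou.
have /choice[g gP] : forall i : 'I_n, exists t, O t /\ e t = i.
  by move=> i; case: (e_surj i (ltn_ord i)) => t; exists t.
have /choice[r rP] : forall t, exists i : 'I_n, O t -> e t = i.
  move=> t; case: (pselect (O t)) => [Ot|nOt].
    by exists (Ordinal (eO _ Ot)).
  by exists (Ordinal (eO _ Ou)).
have gO i : O (g i) by case: (gP i).
have rK t : O t -> g (r t) = t.
  move=> Ot; apply: e_inj; rewrite ?in_setE //.
  by have [_ ->] := gP (r t); rewrite rP.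
have gK i : r (g i) = i by apply: ord_inj; rewrite -rP //; case: (gP i).
pose F i := r (f (g i)).
have gF i : g (F i) = f (g i) by rewrite rK //; apply: fO.
have F_inj : injective F.
  by move=> i j /(congr1 g); rewrite !gF => /f_inj/(congr1 r); rewrite !gK.
have Ftrans i j : exists2 h, h i = j & forall k, h (F k) = F (h k).
  have [h [hi hO hf]] := trans _ _ (gO i) (gO j).
  exists (fun k => r (h (g k))) => [|k]; first by rewrite hi gK.
  by rewrite gF hf /F rK //; apply: hO.
have := iter_card_finType F_inj Ftrans (r u); rewrite card_ord => Fn.
have gFn k i : g (iter k F i) = iter k f (g i).
  by elim: k => //= k <-; rewrite gF.
by rewrite -{1}[u]rK // -gFn Fn rK.
Qed.

(** * Commuting displacements in medial quandles *)

Lemma exists_ldiv (Q : Type) (op : Q -> Q -> Q) :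
  (forall x y, exists! u, op x u = y) ->
  exists ldiv : Q -> Q -> Q,
    (forall a, cancel (op a) (ldiv a)) /\ (forall a, cancel (ldiv a) (op a)).
Proof.
move=> opU.
have /choice[ldiv ldivP] : forall p : Q * Q, exists u, op p.1 u = p.2.
  by move=> [x y]; case: (opU x y) => u [? _]; exists u.
exists (fun a b => ldiv (a, b)); split=> a b; last exact: (ldivP (a, b)).
have [u [_ uniq]] := opU a (op a b).
by have := uniq _ (ldivP (a, op a b)); rewrite (uniq b).
Qed.

(** Mediality [L_(b a) L_c = L_(b c) L_a], with
    [L_(b a) = L_b L_a L_b^-1] by left distributivity. *)
Lemma op_ldiv_op (Q : Type) (op ldiv : Q -> Q -> Q)
    (opK : forall a, cancel (op a) (ldiv a))
    (ldivK : forall a, cancel (ldiv a) (op a))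
    (opD : forall x y z, op x (op y z) = op (op x y) (op x z))
    (hmed : medial op) (a b c w : Q) :
  op a (ldiv b (op c w)) = op c (ldiv b (op a w)).
Proof. by apply: (can_inj (opK b)); rewrite opD [RHS]opD !ldivK hmed. Qed.

Lemma ldiv_op_ldiv (Q : Type) (op ldiv : Q -> Q -> Q)
    (opK : forall a, cancel (op a) (ldiv a))
    (ldivK : forall a, cancel (ldiv a) (op a))
    (opD : forall x y z, op x (op y z) = op (op x y) (op x z))
    (hmed : medial op) (a b c w : Q) :
  ldiv a (op b (ldiv c w)) = ldiv c (op b (ldiv a w)).
Proof.
by apply: (can_inj (opK a)); rewrite [RHS](op_ldiv_op opK ldivK opD hmed) !ldivK.
Qed.

Lemma displacementC (Q : Type) (op ldiv : Q -> Q -> Q)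
    (opK : forall a, cancel (op a) (ldiv a))
    (ldivK : forall a, cancel (ldiv a) (op a))
    (opD : forall x y z, op x (op y z) = op (op x y) (op x z))
    (hmed : medial op) (a b c d w : Q) :
  op a (ldiv b (op c (ldiv d w))) = op c (ldiv d (op a (ldiv b w))).
Proof.
rewrite (op_ldiv_op opK ldivK opD hmed).
by rewrite (ldiv_op_ldiv opK ldivK opD hmed b).
Qed.

(** With [alpha = L_a L_b^-1], the map [L_(alpha z) L_z^-1] does not depend on
    [z]: it is the commutator [L_a L_b L_a^-1 L_b^-1]. *)
Lemma commutatorE (Q : Type) (op ldiv : Q -> Q -> Q)
    (opK : forall a, cancel (op a) (ldiv a))
    (ldivK : forall a, cancel (ldiv a) (op a))
    (opD : forall x y z, op x (op y z) = op (op x y) (op x z))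
    (hmed : medial op) (a b z w : Q) :
  op (op a (ldiv b z)) (ldiv z w) = op a (op b (ldiv a (ldiv b w))).
Proof.
(* In terms of [u = b \ z], the conjugation formula reads
   [L_(a u) = L_a L_u L_a^-1] and [L_(b u)^-1 = L_b L_u^-1 L_b^-1]. *)
rewrite -[z in ldiv z w](ldivK b); set u := ldiv b z.
have -> : ldiv (op b u) w = op b (ldiv u (ldiv b w)).
  by apply: (can_inj (opK (op b u))); rewrite ldivK -opD !ldivK.
rewrite -[op b (ldiv u _)](ldivK a) -opD.
by rewrite (ldiv_op_ldiv opK ldivK opD hmed) ldivK.
Qed.

(** The powers telescope, because each factor may be computed at the base point
    [alpha^n z] reached so far. *)
Lemma iter_commutator (Q : Type) (op ldiv : Q -> Q -> Q)
    (opK : forall a, cancel (op a) (ldiv a))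
    (ldivK : forall a, cancel (ldiv a) (op a))
    (opD : forall x y z, op x (op y z) = op (op x y) (op x z))
    (hmed : medial op) (a b z w : Q) (n : nat) :
  iter n (fun v => op a (op b (ldiv a (ldiv b v)))) w =
  op (iter n (fun v => op a (ldiv b v)) z) (ldiv z w).
Proof.
elim: n => [|n /= ->]; first by rewrite /= ldivK.
set zn := iter n _ z.
by rewrite -(commutatorE opK ldivK opD hmed a b zn) opK.
Qed.

(** * Displacements on the orbits *)

(** The displacement [L_a L_u^-1] moves [u] as [L_a] does, so the centralizer of
    a displacement [L_x L_y^-1] already connects all points of an orbit.
    Bijectivity is recorded so that the induction passes through inverses. *)
Lemma LMlt_centralizer (Q : Type) (op ldiv : Q -> Q -> Q)
    (opK : forall a, cancel (op a) (ldiv a))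
    (ldivK : forall a, cancel (ldiv a) (op a))
    (idem : forall x, op x x = x)
    (opD : forall x y z, op x (op y z) = op (op x y) (op x z))
    (hmed : medial op) (x y : Q) (g : Q -> Q) :
  LMlt op g -> forall u, exists h,
    [/\ h u = g u, LMlt op h, bijective h
      & forall w, h (op x (ldiv y w)) = op x (ldiv y (h w))].
Proof.
have LMlt_ldiv a : LMlt op (ldiv a) by apply: LMlt_inv (LMlt_gen op a) _ _.
elim=> {g} [a u||g1 g2 _ IH1 _ IH2 u|g g' _ IH gK g'K u].
- exists (op a \o ldiv u); split=> [|||w] /=.
  + by congr op; rewrite -{2}[u]idem opK.
  + by apply: LMlt_comp; [apply: LMlt_gen | apply: LMlt_ldiv].
  + by exists (op u \o ldiv a) => w; rewrite /= opK ldivK.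
  + exact: (displacementC opK ldivK opD hmed).
- by move=> u; exists id; split=> //; [apply: LMlt_id | exists id].
- have [h2 [h2u L2 bij2 c2]] := IH2 u; have [h1 [h1u L1 bij1 c1]] := IH1 (g2 u).
  exists (h1 \o h2); split=> [|||w] /=.
  + by rewrite h2u.
  + exact: LMlt_comp.
  + exact: bij_comp.
  + by rewrite c2 c1.
- have [h [hu Lh [h' hK h'K] hc]] := IH (g' u).
  exists h'; split=> [|||w].
  + by rewrite -{1}[u]g'K -hu hK.
  + exact: LMlt_inv Lh hK h'K.
  + by exists h.
  + by apply: (can_inj hK); rewrite hc !h'K.
Qed.

Lemma iter_displacement_orbit (Q : Type) (op ldiv : Q -> Q -> Q)
    (opK : forall a, cancel (op a) (ldiv a))
    (ldivK : forall a, cancel (ldiv a) (op a))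
    (idem : forall x, op x x = x)
    (opD : forall x y z, op x (op y z) = op (op x y) (op x z))
    (hmed : medial op) (x y z : Q) (n : nat) :
  orbit_of op z #= `I_n -> iter n (fun w => op x (ldiv y w)) z = z.
Proof.
move=> cardO; have LMlt_orbit g : LMlt op g -> {homo g : u / orbit_of op z u}.
  by move=> Lg _ [k Lk <-]; exists (g \o k) => //; apply: LMlt_comp.
apply: (iter_card_fixed cardO); last by exists id => //; apply: LMlt_id.
- exact: inj_comp (can_inj (opK x)) (can_inj (ldivK y)).
- apply: (LMlt_orbit (op x \o ldiv y)); apply: LMlt_comp; first exact: LMlt_gen.
  exact: LMlt_inv (LMlt_gen op y) _ _.
move=> _ _ [k1 L1 <-] [k2 L2 <-].
have [h1 [h1z Lh1 [h1' h1K h1'K] c1]] :=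
  LMlt_centralizer opK ldivK idem opD hmed x y L1 z.
have [h2 [h2z Lh2 _ c2]] := LMlt_centralizer opK ldivK idem opD hmed x y L2 z.
exists (h2 \o h1'); split=> [||w] /=.
- by rewrite -h1z h1K.
- by apply: LMlt_orbit; apply: LMlt_comp Lh2 (LMlt_inv Lh1 h1K h1'K).
- by rewrite -c2; congr h2; apply: (can_inj h1K); rewrite c1 !h1'K.
Qed.

Theorem corollary6p3 (Q : Type) (op : Q -> Q -> Q)
    (hQ : is_quandle op) (hmed : medial op)
    (hcop : coprime_orbit_sizes op) :
  reductive 3 op.
Proof.
case: hQ => idem opD /exists_ldiv[ldiv [opK ldivK]] x y.
pose delta v := op x (op y (ldiv x (ldiv y v))).
have [d [delta_d d_dvd]] := exists_period delta y.
have d1 : d = 1.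
  apply: hcop => _ n [z _ <-] /(iter_displacement_orbit opK ldivK idem opD hmed).
  move=> /(_ x y) alpha_n; apply: d_dvd.
  by rewrite (iter_commutator opK ldivK opD hmed x y z) alpha_n ldivK.
have yy : ldiv y y = y by rewrite -{2}[y]idem opK.
have red2 : op (op x y) y = y.
  have := commutatorE opK ldivK opD hmed x y y y; rewrite yy => ->.
  by move: delta_d; rewrite d1 /= /delta yy.
by rewrite /= red2 idem.
Qed.
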